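(* Let $(\mathfrak{g},[\cdot,\cdot]_{\mathfrak{g}},B_{\mathfrak{g}})$ be a quadratic Lie algebra over $\mathbb{F}$. Let $(\mathfrak{G},[\cdot,\cdot]_{\mathfrak{G}})$ be a central extension of $(\mathfrak{g},[\cdot,\cdot]_{\mathfrak{g}})$ by a vector space $V$, and assume that $\dim_{\mathbb{F}}V\le2$. If there exists an invariant metric on $(\mathfrak{G},[\cdot,\cdot]_{\mathfrak{G}})$, then the short exact sequence $0\to V\to\mathfrak{G}\xrightarrow{\pi_{\mathfrak{g}}}\mathfrak{g}\to0$ associated to the extension splits, i.e. there is a Lie algebra morphism $\alpha:\mathfrak{g}\to\mathfrak{G}$ with $\pi_{\mathfrak{g}}\circ\alpha=\operatorname{Id}_{\mathfrak{g}}$.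
   Context: All Lie algebras are finite-dimensional over an algebraically closed field $\mathbb{F}$ of characteristic zero. An invariant metric on a Lie algebra $\mathfrak{g}$ is a non-degenerate symmetric bilinear form $B_{\mathfrak{g}}$ with $B_{\mathfrak{g}}(x,[y,z]_{\mathfrak{g}})=B_{\mathfrak{g}}([x,y]_{\mathfrak{g}},z)$ for all $x,y,z$; a quadratic Lie algebra is a Lie algebra with an invariant metric. A 2-cocycle of $\mathfrak{g}$ with values in $V$ is a skew-symmetric bilinear map $\theta:\mathfrak{g}\times\mathfrak{g}\to V$ with $\theta(x,[y,z]_{\mathfrak{g}})+\theta(y,[z,x]_{\mathfrak{g}})+\theta(z,[x,y]_{\mathfrak{g}})=0$. The central extension of $\mathfrak{g}$ by $V$ associated to $\theta$ is $\mathfrak{G}=\mathfrak{g}\oplus V$ with bracket $[x+u,y+v]_{\mathfrak{G}}=[x,y]_{\mathfrak{g}}+\theta(x,y)$; $\pi_{\mathfrak{g}}:\mathfrak{G}\to\mathfrak{g}$ is the projection. *)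

(* Defs.v *)
From HB Require Import structures.
From mathcomp Require Import all_boot all_order all_algebra.

Set Implicit Arguments.
Unset Strict Implicit.
Unset Printing Implicit Defensive.

Import GRing.Theory.
Local Open Scope ring_scope.

(* Finite-dimensional Lie algebras. Skew-symmetry is used in place of          *)
(* [x, x] = 0: the two agree when 2 is invertible, in particular over the      *)
(* fields of characteristic zero considered here, and 2-cocycles are likewise  *)
(* only required to be skew-symmetric.                                         *)
HB.mixin Record isLieAlgebra (F : fieldType) L of Vector F L := {
  lie : L -> L -> L;
  lie_bilinear_subproof : bilinear_for *:%R *:%R lie;
  lie_skew : forall x y, lie x y = - lie y x;
  lie_jacobi : forall x y z,
    lie x (lie y z) + lie y (lie z x) + lie z (lie x y) = 0
}.

#[short(type="lieAlgType")]
HB.structure Definition LieAlgebra (F : fieldType) :=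
  {L of isLieAlgebra F L & Vector F L}.

HB.instance Definition _ (F : fieldType) (L : lieAlgType F) :=
  bilinear_isBilinear.Build F L L L _ _ (@lie F L)
    (@lie_bilinear_subproof F L).

Notation "[Lie x , y ]" := (lie x y)
  (at level 0, x, y at level 99, format "[Lie  x ,  y ]") : ring_scope.

Definition invariant_metric (F : fieldType) (L : lieAlgType F)
    (B : {symmetric L}) : Prop :=
  nondegenerate B /\ forall x y z : L, B x [Lie y, z] = B [Lie x, y] z.

Definition cocycle (F : fieldType) (L : lieAlgType F) (V : vectType F)
    (theta : {bilinear L -> L -> V}) : Prop :=
  (forall x y, theta x y = - theta y x) /\
  (forall x y z, theta x [Lie y, z] + theta y [Lie z, x]
                 + theta z [Lie x, y] = 0).

Definition lie_morphism (F : fieldType) (L M : lieAlgType F)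
    (f : {linear L -> M}) : Prop :=
  forall x y, f [Lie x, y] = [Lie f x, f y].

(* The proof of the cocycle identity is an argument of the type, so that the   *)
(* Lie algebra structure on L (+) V can be inferred from it.                   *)
Definition central_ext (F : fieldType) (L : lieAlgType F) (V : vectType F)
  (theta : {bilinear L -> L -> V}) (thetaP : cocycle theta) : Type :=
  (L * V)%type.

Section CentralExtension.
Variables (F : fieldType) (L : lieAlgType F) (V : vectType F).
Variables (theta : {bilinear L -> L -> V}) (thetaP : cocycle theta).

Local Notation G := (central_ext thetaP).

HB.instance Definition _ := Vector.copy G (L * V)%type.

Definition central_ext_lie (p q : G) : G := ([Lie p.1, q.1], theta p.1 q.1).

Fact central_ext_lie_bilinear : bilinear_for *:%R *:%R central_ext_lie.
Proof.
by split=> [q a p p'|p a q q']; congr (_, _);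
  rewrite /= ?linearPl ?linearPr.
Qed.

Fact central_ext_lie_skew p q : central_ext_lie p q = - central_ext_lie q p.
Proof. by congr (_, _); [exact: lie_skew | exact: thetaP.1]. Qed.

Fact central_ext_lie_jacobi p q r :
  central_ext_lie p (central_ext_lie q r) +
  central_ext_lie q (central_ext_lie r p) +
  central_ext_lie r (central_ext_lie p q) = 0.
Proof. by congr (_, _); [exact: lie_jacobi | exact: thetaP.2]. Qed.

HB.instance Definition _ := isLieAlgebra.Build F G
  central_ext_lie_bilinear central_ext_lie_skew central_ext_lie_jacobi.

Definition central_ext_proj (p : G) : L := p.1.

Definition central_ext_splits : Prop :=
  exists alpha : {linear L -> G},
    lie_morphism alpha /\ forall x, central_ext_proj (alpha x) = x.

End CentralExtension.

(* Main.v *)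
(* Since V is central, the extension splits as soon as W = V :&: [G, G] is     *)
(* zero: project onto V along [G, G]. Let Z(L) = [L, L]^perp be the center of  *)
(* a quadratic Lie algebra L, and let C be the preimage of Z(g) in G. The      *)
(* equalities dim Z(L) + dim [L, L] = dim L for L = g and L = G give           *)
(* dim C = dim Z(G) + dim W. If W is nonzero, choose e not orthogonal to W:    *)
(* ad e maps C into W :&: e^perp, of dimension dim W - 1 <= 1, and the kernel  *)
(* of ad e on C is central in G, because an element y with [y, G] contained in *)
(* a line is central. Hence dim C < dim Z(G) + dim W, a contradiction.         *)
Require Import Defs.
From HB Require Import structures.
From mathcomp Require Import all_boot all_order all_algebra.
From mathcomp Require Import zify.

Set Implicit Arguments.
Unset Strict Implicit.
Unset Printing Implicit Defensive.

Import GRing.Theory.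
Local Open Scope ring_scope.

(** With K the kernel of the projection, the obstruction to splitting is W = K ∩ [G, G]
    ([lie_section]). Counting dimensions with both metrics ([dimv_orthov], [orthov_derivedP]) fixes
    the dimension of the preimage C of Z(g), while [C, G] inside W bounds it strictly from above if
    W is nonzero ([dim_lie_in_ltn]); [ker_cap_derived] confronts the two. The bound dim V <= 2 makes
    a hyperplane of W at most a line, as [central_of_lie_in_line] demands. *)

(** Each basis vector of [V] imposes one linear equation on [U]. *)
Lemma dimv_cap_orthov (F : fieldType) (vT : vectType F) (B : {symmetric vT})
    (U V : {vspace vT}) :
  (\dim U <= \dim V + \dim (U :&: orthov B V))%N.
Proof.
pose K (s : seq vT) n := (\bigcap_(i < n) orthov B <[s`_i]>)%VS.
suff le_dim s n : (\dim U <= n + \dim (U :&: K s n))%N.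
  by rewrite /orthov; under eq_bigr do rewrite -orthov1E; apply: le_dim.
elim: n => [|n IHn]; first by rewrite /K big_ord0 capvf.
rewrite /K big_ord_recr /= capvA.
have := leq_dim_orthov1 B s`_n (U :&: K s n); rewrite -subn1 leq_subLR.
by rewrite -(leq_add2l n) addnA addn1 => /(leq_trans IHn).
Qed.

Lemma nondegenerate_neq0 (F : fieldType) (vT : vectType F)
    (B : {symmetric vT}) (u : vT) :
  nondegenerate B -> u != 0 -> exists v, B u v != 0.
Proof.
move=> /eqP Bnd; rewrite -memv0 -Bnd => /mem_orthovPn[v _ uv].
by exists v.
Qed.

Lemma dimv_orthov (F : fieldType) (vT : vectType F) (B : {symmetric vT})
    (U : {vspace vT}) :
  nondegenerate B -> (\dim U + \dim (orthov B U) = \dim {:vT})%N.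
Proof.
move=> Bnd.
have le1 := dimv_cap_orthov B fullv U; rewrite capfv in le1.
(* The reverse inequality: a vector of [U] orthogonal to a complement of [orthov B U] is orthogonal
   to the whole space, hence zero. *)
have le2 := dimv_cap_orthov B U (orthov B U)^C.
suff U0 : (U :&: orthov B (orthov B U)^C = 0)%VS.
  by move: le2; rewrite U0 dimv0 dimv_compl; have := dimvS (subvf (orthov B U)); lia.
apply/eqP; rewrite -subv0; apply/subvP => u /memv_capP[uU uC].
rewrite memv0; apply: contraT => /(nondegenerate_neq0 Bnd)[v].
have: v \in (orthov B U + (orthov B U)^C)%VS by rewrite addv_complf memvf.
case/memv_addP => v1 v1U [v2 v2U ->]; rewrite linearDr /=.
rewrite (mem_orthovP uC v2 v2U) addr0 herm_eq0C.
by rewrite (mem_orthovP v1U u uU) eqxx.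
Qed.

Section QuadraticLieAlgebra.
Variables (F : fieldType) (two_neq0 : 2%:R != 0 :> F) (L : lieAlgType F).
Implicit Types (B : {symmetric L}) (U : {vspace L}).

HB.instance Definition _ (x : L) :=
  GRing.isLinear.Build F L L *:%R (lie x) (linearPr (@lie F L) x).

Definition derived : {vspace L} :=
  <<[seq [Lie x, y] | x <- vbasis {:L}, y <- vbasis {:L}]>>%VS.

Lemma lie_derived (x y : L) : [Lie x, y] \in derived.
Proof.
rewrite (coord_vbasis (memvf x)) (coord_vbasis (memvf y)).
rewrite linear_sumlz; apply: memv_suml => i _.
rewrite linearZl_LR linear_sumr; apply: memvZ.
apply: memv_suml => j _; rewrite linearZr_LR; apply: memvZ.
by apply/memv_span/allpairs_f; apply/mem_nth; rewrite size_tuple.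
Qed.

Lemma derived_sub U : (forall x y, [Lie x, y] \in U) -> (derived <= U)%VS.
Proof. by move=> U_lie; apply/span_subvP => _ /allpairsP[? [_ _ ->]]. Qed.

Lemma eq_opp0 (V : lmodType F) (v : V) : v = - v -> v = 0.
Proof.
move=> /eqP; rewrite -addr_eq0 -mulr2n -scaler_nat scaler_eq0 (negPf two_neq0).
by move/eqP.
Qed.

Lemma liexx (x : L) : [Lie x, x] = 0.
Proof. exact/eq_opp0/lie_skew. Qed.

(** Invariance rewrites [B z [Lie x, y]] as [B [Lie z, x] y], so by non-degeneracy the orthogonal of
    [L, L] is the center. *)
Lemma orthov_derivedP B : invariant_metric B ->
  forall z, reflect (forall x, [Lie z, x] = 0) (z \in orthov B derived).
Proof.
move=> [Bnd Binv] z; apply: (iffP idP) => [/mem_orthovP zD x|zC].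
  apply/eqP; apply: contraT => /(nondegenerate_neq0 Bnd)[y].
  by rewrite -Binv zD ?lie_derived ?eqxx.
rewrite mem_orthov_sym; apply: derived_sub => x y.
by rewrite mem_orthov1 herm_eq0C Binv zC linear0l.
Qed.

(* If [y, -] takes values in a line, the form [B [y, x] z], which is skew in  *)
(* x and z, has rank at most one, hence vanishes.                             *)
Lemma central_of_lie_in_line B (y : L) U : invariant_metric B ->
  (\dim U <= 1)%N -> (forall x, [Lie y, x] \in U) -> forall x, [Lie y, x] = 0.
Proof.
move=> [Bnd Binv] dimU yU x; apply/eqP; apply: contraT => yx_neq0.
have [z Byxz] := nondegenerate_neq0 Bnd yx_neq0.
have defU : <[ [Lie y, x] ]>%VS = U.
  by apply/eqP; rewrite eqEdim -memvE yU dim_vline yx_neq0.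
have yz0 : [Lie y, z] = 0.
  have /vlineP[c yzE] : [Lie y, z] \in <[ [Lie y, x] ]>%VS by rewrite defU.
  have: B [Lie y, z] z = 0 by rewrite -Binv liexx linear0r.
  rewrite yzE linearZl_LR => /eqP; rewrite mulf_eq0 (negPf Byxz) orbF.
  by move=> /eqP->; rewrite scale0r.
by move: Byxz; rewrite -Binv lie_skew linearNr /= Binv yz0 linear0l oppr0 eqxx.
Qed.

(** Rank-nullity for ad e on [C], where [e] is not orthogonal to [W]: the kernel is central and the
    image lies in a hyperplane of [W]. *)
Lemma dim_lie_in_ltn B (W C : {vspace L}) : invariant_metric B ->
  W != 0%VS -> (\dim W <= 2)%N -> (forall y x, y \in C -> [Lie y, x] \in W) ->
  (\dim C < \dim (orthov B derived) + \dim W)%N.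
Proof.
move=> BP; have [Bnd Binv] := BP => W_neq0 dimW CW.
have [e We] : exists e, B (vpick W) e != 0.
  by apply: nondegenerate_neq0; rewrite ?vpick0.
have eW : e \notin orthov B W.
  by apply/mem_orthovPn; exists (vpick W); rewrite ?memv_pick // herm_eq0C.
have dimWe := eq_dim_orthov1 eW.
pose ad_e := linfun (lie e : L -> L).
have ad_eE y : ad_e y = [Lie e, y] by rewrite lfunE.
have kerZ : (C :&: lker ad_e <= orthov B derived)%VS.
  apply/subvP => y /memv_capP[yC]; rewrite memv_ker ad_eE => /eqP ey.
  apply/(orthov_derivedP BP).
  (* As [y] commutes with [e], invariance makes every [[Lie y, x]] orthogonal to [e]. *)
  apply: (central_of_lie_in_line (U := W :&: orthov B <[e]>) BP).
    by rewrite -dimWe; lia.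
  move=> x; apply/memv_capP; split; first exact: CW.
  rewrite mem_orthov1 -Binv lie_skew linearNr /= Binv lie_skew ey.
  by rewrite oppr0 linear0l oppr0.
have imW : (ad_e @: C <= W :&: orthov B <[e]>)%VS.
  apply/subvP => _ /memv_imgP[y yC ->]; rewrite ad_eE.
  rewrite memv_cap lie_skew memvN CW //= mem_orthov1.
  by rewrite linearNl /= -Binv liexx linear0r oppr0.
have := limg_ker_dim ad_e C; have := dimvS kerZ; have := dimvS imW.
by rewrite -dimWe -dimv_eq0 in W_neq0 *; lia.
Qed.

End QuadraticLieAlgebra.

Arguments derived {F} L.

Section CentralExtension.
Variables (F : fieldType) (two_neq0 : 2%:R != 0 :> F) (G g : lieAlgType F).
Variables (pi : 'Hom(G, g)).
Hypothesis pi_lie : lie_morphism pi.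
Hypothesis pi_surj : limg pi = fullv.
Hypothesis ker_central : forall k x, k \in lker pi -> [Lie k, x] = 0.

Lemma limg_derived : (pi @: derived G)%VS = derived g.
Proof.
have pi_im (x : g) : exists x', x = pi x'.
  by have: x \in limg pi by [rewrite pi_surj memvf]; case/memv_imgP => x' _ ->; exists x'.
apply/eqP; rewrite eqEsubv; apply/andP; split.
  apply/subvP => _ /memv_imgP[x xD ->]; rewrite memv_preim.
  apply: subvP xD; apply: derived_sub => u v.
  by rewrite -memv_preim pi_lie lie_derived.
apply: derived_sub => x y; have [[x' ->] [y' ->]] := (pi_im x, pi_im y).
by rewrite -pi_lie memv_img ?lie_derived.
Qed.

Lemma ker_cap_derived (BG : {symmetric G}) (Bg : {symmetric g}) :
  invariant_metric BG -> invariant_metric Bg -> (\dim (lker pi) <= 2)%N ->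
  (lker pi :&: derived G = 0)%VS.
Proof.
move=> BGP BgP dimK; set W := (_ :&: _)%VS; apply/eqP; apply: contraT => W_neq0.
pose C := (pi @^-1: orthov Bg (derived g))%VS.
have dimW : (\dim W <= 2)%N by apply: leq_trans (dimvS (capvSl _ _)) dimK.
have CW y x : y \in C -> [Lie y, x] \in W.
  rewrite -memv_preim => /(orthov_derivedP BgP) yC.
  by rewrite memv_cap lie_derived andbT memv_ker pi_lie yC.
have := dim_lie_in_ltn two_neq0 BGP W_neq0 dimW CW.
(* The rest shows dim C = dim K + dim g - dim [g, g] = dim G - dim [G, G] + dim W = dim Z(G) + dim
   W, against the strict bound. *)
have [BGnd _] := BGP; have [Bgnd _] := BgP.
have KC : (lker pi <= C)%VS.
  by apply/subvP => k; rewrite memv_ker -memv_preim => /eqP->; apply: mem0v.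
have dimC := limg_ker_dim pi C.
rewrite (capv_idPr KC) lpreimK ?pi_surj ?subvf // in dimC.
have dimG := limg_ker_dim pi fullv; rewrite capfv pi_surj in dimG.
have dimD := limg_ker_dim pi (derived G); rewrite limg_derived capvC in dimD.
have := dimv_orthov (derived G) BGnd; have := dimv_orthov (derived g) Bgnd.
rewrite -/W in dimD; lia.
Qed.

(** A linear section s is corrected to s - p s, where p is the identity on the kernel and kills
    [G, G]; the correction is central, so it leaves brackets unchanged. *)
Lemma lie_section : (lker pi :&: derived G = 0)%VS ->
  exists alpha : {linear g -> G}, lie_morphism alpha /\ cancel alpha pi.
Proof.
move=> KD0; pose p := daddv_pi (lker pi) (derived G).
have pD d : d \in derived G -> p d = 0.
  move=> dD; have DK0 : (derived G :&: lker pi = 0)%VS by rewrite capvC.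
  have := daddv_pi_add KD0 (subvP (addvSr _ _) _ dD).
  by rewrite (daddv_pi_id DK0 dD) -[RHS]add0r => /addIr.
have pK x : p x \in lker pi := memv_pi _ _ _.
have pi_s x : pi ((pi^-1)%VF x) = x by rewrite limg_lfunVK // pi_surj memvf.
pose alpha : 'Hom(g, G) := pi^-1%VF - (p \o pi^-1)%VF.
have alphaE x : alpha x = (pi^-1)%VF x - p ((pi^-1)%VF x).
  by rewrite add_lfunE opp_lfunE comp_lfunE.
have pi_p x : pi (p x) = 0 by apply/eqP; rewrite -memv_ker.
exists alpha; split=> [x y|x]; last by rewrite /= alphaE linearB /= pi_s pi_p subr0.
set s := (pi^-1)%VF in pi_s alphaE *.
have -> : [Lie alpha x, alpha y] = [Lie s x, s y].
  rewrite !alphaE linearBl /= (ker_central _ (pK _)) subr0.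
  by rewrite lie_skew linearBl /= (ker_central _ (pK _)) subr0 -lie_skew.
(* [p] fixes this defect and kills [[Lie s x, s y]], so the defect is exactly [p (s [Lie x, y])]. *)
have kK : s [Lie x, y] - [Lie s x, s y] \in lker pi.
  by rewrite memv_ker linearB /= pi_lie /= !pi_s subrr.
rewrite /= alphaE; have := daddv_pi_id KD0 kK; rewrite -/p linearB /=.
rewrite (pD _ (lie_derived _ _)) subr0 => ->.
by rewrite opprB addrC subrK.
Qed.

End CentralExtension.

Theorem proposition3p7 (F : closedFieldType) (charF : [pchar F] =i pred0)
  (g : lieAlgType F) (Bg : {symmetric g}) (BgP : invariant_metric Bg)
  (V : vectType F) (dimV : (\dim {:V} <= 2)%N)
  (theta : {bilinear g -> g -> V}) (thetaP : cocycle theta)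
  (quadG : exists BG : {symmetric (central_ext thetaP)}, invariant_metric BG) :
  central_ext_splits thetaP.
Proof.
have two_neq0 : 2%:R != 0 :> F by have := charF 2%N; rewrite !inE /= => ->.
have [BG BGP] := quadG; pose G : lieAlgType F := central_ext thetaP.
pose pi : 'Hom(G, g) := linfun (fst : g * V -> g).
have piE (x : G) : pi x = x.1 by rewrite lfunE.
have pi_lie : lie_morphism pi by move=> x y; rewrite /= !piE.
have pi_surj : limg pi = fullv.
  apply/eqP; rewrite eqEsubv subvf; apply/subvP => x _.
  by apply/memv_imgP; exists ((x, 0) : G); rewrite ?memvf ?piE.
have ker_central (k x : G) : k \in lker pi -> [Lie k, x] = 0.
  rewrite memv_ker piE => /eqP k0.
  by congr (_, _); rewrite k0 linear0l.
have dimK : (\dim (lker pi) <= 2)%N.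
  (* The kernel has dimension dim (g * V) - dim g = dim V. *)
  have := limg_ker_dim pi fullv; rewrite capfv pi_surj !dimvf.
  by rewrite dimvf in dimV; rewrite [dim G]/dim /=; lia.
have [alpha [alpha_lie alphaK]] :=
  lie_section pi_lie pi_surj ker_central
    (ker_cap_derived two_neq0 pi_lie pi_surj BGP BgP dimK).
by exists alpha; split=> // x; rewrite -[RHS]alphaK piE.
Qed.
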